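(* Let $q$ be a power of two, let $A$ be a $q$-modular witness in a graph $G$, and let $U\subseteq A$ with $|U|=m\ge2$. For $B\subseteq U$ let $n_B$ be the number of vertices $x\in A\setminus U$ with $N(x)\cap U=B$. Let $H_2$ be the graph on vertex set $U$ in which $xy$ is an edge iff $n_{\{x,y\}}\ge q$. Suppose $H_2$ is connected, and, if $m$ is even, suppose in addition there is a subset $C\subseteq U$ of odd cardinality with $n_C\ge q$. Then the classes $[\mathbf 1_B]$ with $n_B\ge q$ span $\mathbb F_2^U/\langle\mathbf 1_U\rangle$. Consequently there is a set $E\subseteq A\setminus U$ with $|E|\le q(m-1)$, a union of pairwise disjoint $q$-element sets of vertices each having a common trace on $U$, such that with $W=A\setminus E$ all degrees $\deg_W(u)$, $u\in U$, are congruent modulo $2q$. If, after this deletion, every vertex of $W\setminus U$ has the same degree residue modulo $2q$ in $G[W]$ as the vertices of $U$, then $W$ is $2q$-modular.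
   Context: Graphs are finite simple; $\deg_S(v)$ is the degree of $v$ in $G[S]$; $S$ is $q$-modular if all $\deg_S(v)$, $v\in S$, are congruent modulo $q$. The trace of $x$ on $U$ is $N(x)\cap U$. $\mathbf 1_B\in\mathbb F_2^U$ is the indicator vector of $B$; the quotient is by the all-ones vector $\mathbf 1_U$. *)

(* Defs.v *)
From HB Require Import structures.
From mathcomp Require Import all_boot all_order all_algebra.

Set Implicit Arguments.
Unset Strict Implicit.
Unset Printing Implicit Defensive.

Import GRing.Theory.
Local Open Scope ring_scope.

Section VectorQuotient.
Local Open Scope quotient_scope.
Variables (K : fieldType) (vT : vectType K) (V : {vspace vT}).

Definition vquot := Quotient.quot (pred_of_vspace V).

HB.instance Definition _ : EqQuotient vT (Quotient.equiv (pred_of_vspace V)) vquot :=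
  EqQuotient.on vquot.
HB.instance Definition _ := GRing.Zmodule.on vquot.

Definition vclass (v : vT) : vquot := \pi_vquot v.

Lemma vclass_eq (v w : vT) : (vclass v == vclass w) = (v - w \in V).
Proof. by rewrite /vclass -Quotient.idealrBE. Qed.

Lemma vclass_reprK (x : vquot) : vclass (repr x) = x.
Proof. exact: reprK. Qed.

Lemma vclassD (v w : vT) : vclass (v + w) = vclass v + vclass w.
Proof. by rewrite /vclass raddfD. Qed.

Definition vquot_scale (a : K) (x : vquot) : vquot := vclass (a *: repr x).

Lemma vclassZ_subproof (a : K) (v : vT) :
  vclass (a *: v) = vquot_scale a (vclass v).
Proof.
apply/eqP; rewrite vclass_eq -scalerBr memvZ // -vclass_eq.
by rewrite vclass_reprK.
Qed.

Lemma vquot_scaleA a b (x : vquot) :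
  vquot_scale a (vquot_scale b x) = vquot_scale (a * b) x.
Proof. by rewrite -vclassZ_subproof scalerA. Qed.

Lemma vquot_scale1 : left_id 1 vquot_scale.
Proof. by move=> x; rewrite /vquot_scale scale1r vclass_reprK. Qed.

Lemma vquot_scaleDr : right_distributive vquot_scale +%R.
Proof.
move=> a x y; rewrite -[x]vclass_reprK -[y]vclass_reprK -vclassD.
by rewrite -!vclassZ_subproof scalerDr vclassD.
Qed.

Lemma vquot_scaleDl (x : vquot) : {morph vquot_scale^~ x : a b / a + b}.
Proof. by move=> a b; rewrite /vquot_scale scalerDl vclassD. Qed.

HB.instance Definition _ := GRing.Zmodule_isLmodule.Build K vquot
  vquot_scaleA vquot_scale1 vquot_scaleDr vquot_scaleDl.

Lemma vclass_is_linear : linear vclass.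
Proof. by move=> a v w; rewrite vclassD vclassZ_subproof. Qed.

HB.instance Definition _ := GRing.isLinear.Build K vT vquot _ vclass vclass_is_linear.

(* The quotient is identified with the complement of V through the projection
   along V. *)
Definition vquot_compl (x : vquot) : subvs_of V^C :=
  vsproj V^C (repr x - projv V (repr x)).

Lemma vquot_complE (v : vT) :
  vquot_compl (vclass v) = vsproj V^C (v - projv V v).
Proof.
congr vsproj; apply/eqP; set w := repr _.
have wv : w - v \in V by rewrite -vclass_eq vclass_reprK.
have := projv_id wv; rewrite raddfB /= => e.
by rewrite subr_eq addrAC -addrA e addrC subrK.
Qed.

Lemma vquot_compl_is_linear : linear vquot_compl.
Proof.
move=> a x y; rewrite -[x]vclass_reprK -[y]vclass_reprK -linearP !vquot_complE.
by rewrite -linearP [projv V _]linearP scalerBr opprD addrACA.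
Qed.

Lemma vquot_compl_bij : bijective vquot_compl.
Proof.
exists (fun w => vclass (vsval w)) => [x | w].
  rewrite -[x in RHS]vclass_reprK /vquot_compl; apply/eqP.
  by rewrite vclass_eq vsprojK ?memv_projC // addrC addKr memvN memv_proj.
rewrite vquot_complE; suff -> : projv V (vsval w) = 0 by rewrite subr0 vsvalK.
apply/eqP; rewrite -memv0 -(capv_compl V) memv_cap memv_proj /=.
by rewrite -[projv V _](subKr (vsval w)) rpredB ?subvsP ?memv_projC.
Qed.

Lemma vquot_vect_iso : Vector.axiom (\dim V^C) vquot.
Proof.
have [f f_lin f_bij] := subvs_vect_iso V^C.
exists (f \o vquot_compl) => [a x y /= |]; last exact: bij_comp vquot_compl_bij.
by rewrite vquot_compl_is_linear f_lin.
Qed.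

HB.instance Definition _ := Lmodule_hasFinDim.Build K vquot vquot_vect_iso.

End VectorQuotient.

Record sgraph := SGraph {
  vertex :> finType;
  adj : rel vertex;
  adj_sym : symmetric adj;
  adj_irr : irreflexive adj }.

Definition connected (G : sgraph) : Prop := forall x y : G, connect (@adj G) x y.

Section Modular.
Variable G : sgraph.
Implicit Types (A U S B E : {set G}) (q d : nat).

Definition nbhd (x : G) : {set G} := [set y | adj x y].

Definition deg S (v : G) : nat := #|nbhd v :&: S|.

Definition congruent_deg d S (T : {set G}) : Prop :=
  {in T &, forall u v : G, (deg S u = deg S v %[mod d])%N}.

Definition modular q S : Prop := congruent_deg q S S.

Definition trace U (x : G) : {set G} := nbhd x :&: U.

(* The number written n_B, with its dependence on A and U made explicit. *)
Definition trace_mult A U B : nat := #|[set x in A :\: U | trace U x == B]|.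

Section H2.
Variables (q : nat) (A U : {set G}).

Definition H2_adj : rel {x : G | x \in U} := fun x y =>
  (x != y) && (q <= trace_mult A U [set val x; val y])%N.

Lemma H2_adj_sym : symmetric H2_adj.
Proof. by move=> x y; rewrite /H2_adj eq_sym setUC. Qed.

Lemma H2_adj_irr : irreflexive H2_adj.
Proof. by move=> x; rewrite /H2_adj eqxx. Qed.

Definition H2 : sgraph := SGraph H2_adj_sym H2_adj_irr.
End H2.

(* F_2^U; the regular module ('F_2)^o gives the function space its vector space
   structure over 'F_2. *)
Definition F2pow U := {ffun {x : G | x \in U} -> ('F_2)^o}.

HB.instance Definition _ U := Vector.on (F2pow U).

Definition indic U B : F2pow U := [ffun x => (val x \in B)%:R].

(* The class of 1_B in F_2^U / <1_U>. *)
Definition indic_class U B : vquot <[indic U U]>%VS :=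
  vclass _ (indic U B).

Definition trace_block_union q U E : Prop :=
  exists P : {set {set G}},
    [/\ E = cover P, trivIset P &
        forall X, X \in P ->
          #|X| = q /\ exists B, forall x, x \in X -> trace U x = B].

Definition balancing_deletion q A U E : Prop :=
  [/\ E \subset A :\: U,
      (#|E| <= q * (#|U| - 1))%N,
      trace_block_union q U E &
      congruent_deg (2 * q)%N (A :\: E) U].

End Modular.

(* Main.v *)
(* The edges of H_2 give 1_x + 1_y for all x, y in U by connectivity; together
   with one vector of odd weight (1_U itself when m is odd, 1_C otherwise) they
   generate every 1_x.  As all deg_A(u), u in U, agree modulo q, the parity of
   deg_A(u) / q is a vector f of F_2^U.  The class [f] is a sum of at most
   dim (F_2^U / <1_U>) = m - 1 distinct classes [1_B] with n_B >= q.  Deleting q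
   vertices of trace B for each of these B lowers deg(u) by q times the number
   of chosen B containing u, which makes the parity of deg(u) / q constant. *)
Require Import Defs.
From mathcomp Require Import all_boot all_order all_algebra.

Set Implicit Arguments.
Unset Strict Implicit.
Unset Printing Implicit Defensive.

Import GRing.Theory.
Local Open Scope ring_scope.

(** * Short sums over F_2 and the dimension of a quotient space *)

Lemma span_free_subseq (K : fieldType) (vT : vectType K) (T : eqType)
    (g : T -> vT) (s : seq T) :
  exists t, [/\ subseq t s, free (map g t) & (<<map g t>> = <<map g s>>)%VS].
Proof.
elim: s => [|x s [t [sub_ts free_t span_t]]].
  by exists [::]; split=> //; exact: nil_free.
have [gx_t | gx_t] := boolP (g x \in <<map g t>>%VS).
  exists t; split=> //; first exact: subseq_trans sub_ts (subseq_cons _ _).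
  rewrite /= span_cons -span_t; apply/esym/addv_idPr.
  by rewrite -memvE.
exists (x :: t); split; first by rewrite /= eqxx.
  by rewrite /= free_cons gx_t.
by rewrite /= !span_cons span_t.
Qed.

(** Coefficients in F_2 are 0 or 1, so a linear combination is a subsum. Indices are selected rather
    than vectors, because distinct traces, such as complementary ones, can have the same class. *)
Lemma F2_span_subseq_sum (vT : vectType 'F_2) (T : eqType)
    (g : T -> vT) (s : seq T) (v : vT) :
  v \in <<map g s>>%VS -> exists2 t, subseq t s & v = \sum_(i <- t) g i.
Proof.
elim: s v => [|x s IHs] v /=.
  by rewrite span_nil memv0 => /eqP ->; exists [::]; rewrite ?big_nil.
rewrite span_cons => /memv_addP [_ /vlineP [k ->] [w /IHs [t sub_ts ->] ->]].
have [-> | k1] := eqVneq k 0.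
  by exists t; rewrite ?scale0r ?add0r //; exact: subseq_trans (subseq_cons _ _).
exists (x :: t); first by rewrite /= eqxx.
have -> : k = 1 by apply/val_inj; case: k k1 => [[|[|[]]]].
by rewrite big_cons scale1r.
Qed.

(** Thinning the family to a free one with the same span bounds its length by the dimension; this
    later bounds the number of deleted blocks. *)
Lemma F2_short_sum (vT : vectType 'F_2) (T : eqType)
    (g : T -> vT) (s : seq T) (v : vT) :
  v \in <<map g s>>%VS ->
  exists t, [/\ subseq t s, (size t <= \dim {:vT})%N & v = \sum_(i <- t) g i].
Proof.
have [t [sub_ts /eqP free_t <-]] := span_free_subseq g s.
case/F2_span_subseq_sum => r sub_rt ->; exists r; split=> //.
  exact: subseq_trans sub_ts.
apply: leq_trans (size_subseq sub_rt) _.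
by rewrite -(size_map g) -free_t dimvS ?subvf.
Qed.

(** Rank-nullity for the projection, which is onto with kernel [V]. *)
Lemma dim_vquot (K : fieldType) (vT : vectType K) (V : {vspace vT}) :
  (\dim {:vquot V} + \dim V = \dim {:vT})%N.
Proof.
pose p : 'Hom(vT, vquot V) := linfun (vclass V).
have kerp : lker p = V.
  apply/vspaceP => v; rewrite memv_ker lfunE /= -(subr0 v) -vclass_eq.
  by rewrite subr0 [vclass V 0]linear0.
have imgp : limg p = {:vquot V}%VS.
  apply/vspaceP => x; rewrite memvf -(vclass_reprK x); apply/memv_imgP.
  by exists (repr x); rewrite ?memvf ?lfunE.
by rewrite -(limg_ker_dim p fullv) capfv kerp imgp addnC.
Qed.

(** * Indicator vectors on U and their quotient by the all-ones vector *)

Section TraceSpan.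
Variables (G : sgraph) (U : {set G}).
Implicit Types (B C : {set G}).

Lemma dim_F2pow : \dim {:F2pow U} = #|U|.
Proof. by rewrite dimvf /dim /= muln1 card_sig. Qed.

Lemma indic_self_neq0 : (0 < #|U|)%N -> indic U U != 0.
Proof.
case/card_gt0P => x xU; apply/eqP => /ffunP /(_ (Sub x xU)).
by rewrite !ffunE /= xU.
Qed.

Lemma dim_trace_quotient :
  (0 < #|U|)%N -> \dim {:vquot <[indic U U]>%VS} = (#|U| - 1)%N.
Proof.
move=> U0; have := dim_vquot <[indic U U]>%VS.
by rewrite dim_vline indic_self_neq0 // dim_F2pow => <-; rewrite addnK.
Qed.

Lemma indic_set2 (x y : {x : G | x \in U}) :
  x != y -> indic U [set val x; val y] = indic U [set val x] + indic U [set val y].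
Proof.
move=> xy; apply/ffunP => z; rewrite !ffunE !inE !val_eqE.
have [-> | zx] := eqVneq z x; last by rewrite add0r.
by rewrite (negPf xy) addr0.
Qed.

Lemma indic_sum1 B :
  indic U B = \sum_(x : {x : G | x \in U} | val x \in B) indic U [set val x].
Proof.
apply/ffunP => z; rewrite sum_ffunE ffunE.
have [zB | zB] := boolP (val z \in B).
  rewrite (bigD1 z) //= !ffunE inE eqxx big1 ?addr0 // => x /andP [_ xz].
  by rewrite ffunE inE val_eqE eq_sym (negPf xz).
rewrite big1 // => x xB; rewrite ffunE inE val_eqE.
by have [zx | //] := eqVneq z x; rewrite zx xB in zB.
Qed.

Lemma F2_addvv (v : F2pow U) : v + v = 0.
Proof. by apply/ffunP => x; rewrite !ffunE; apply/val_inj; case: (v x) => [[|[|[]]]]. Qed.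

(** Summing 1_x + 1_y over y in C gives |C| 1_x + 1_C, which is 1_x + 1_C because |C| is odd. Hence
    every 1_x lies in [L], and these form a basis. *)
Lemma indic_full (L : {vspace F2pow U}) C :
  (forall x y : {x : G | x \in U},
     indic U [set val x] + indic U [set val y] \in L) ->
  C \subset U -> odd #|C| -> indic U C \in L -> L = fullv.
Proof.
move=> pairL CU oddC CL.
have oneL (x : {x : G | x \in U}) : indic U [set val x] \in L.
  have sum1 : indic U C = \sum_(y : {x : G | x \in U} | val y \in C)
      (indic U [set val x] + indic U [set val y]) + indic U [set val x].
    rewrite big_split /= -indic_sum1 sumr_const.
    have -> : #|[pred y : {x : G | x \in U} | val y \in C]| = #|C|.
      rewrite -(card_imset _ val_inj); apply: eq_card => y.
      apply/imsetP/idP => [[z zC ->] // | yC].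
      by exists (Sub y (subsetP CU y yC)).
    (* Of the |C| copies of 1_x, all but one cancel in pairs. *)
    rewrite -(odd_double_half #|C|) oddC mulrnDr -muln2 mulnC mulrnA mulr2n.
    by rewrite F2_addvv mul0rn addr0 addrAC F2_addvv add0r.
  rewrite -(addKr (\sum_(y : {x : G | x \in U} | val y \in C)
      (indic U [set val x] + indic U [set val y])) (indic U [set val x])).
  by rewrite -sum1 memvD // memvN memv_suml.
apply/vspaceP => v; rewrite memvf.
have -> : v = \sum_x v x *: indic U [set val x].
  apply/ffunP => z; rewrite sum_ffunE (bigD1 z) //= big1 => [|x xz].
    by rewrite !ffunE inE eqxx addr0 /GRing.scale /= mulr1.
  by rewrite !ffunE inE val_eqE eq_sym (negPf xz) scaler0.
by apply: memv_suml => x _; rewrite memvZ.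
Qed.

End TraceSpan.

(** * Spanning the quotient by frequent traces *)

Section Balancing.
Variables (G : sgraph) (q : nat) (A U : {set G}).

Definition frequent_traces : pred {set G} :=
  [pred B : {set G} | (B \subset U) && (q <= trace_mult A U B)%N].

Lemma frequent_traces_span :
  (0 < #|U|)%N -> connected (H2 q A U) ->
  (~~ odd #|U| ->
     exists C : {set G}, [/\ C \subset U, odd #|C| & (q <= trace_mult A U C)%N]) ->
  <<[seq indic_class U B | B in frequent_traces]>>%VS = fullv.
Proof.
move=> U0 connH oddC; set S := <<_>>%VS.
(* Pulling the span back along the projection lets the argument use vectors instead of classes. *)
pose p := linfun (vclass <[indic U U]>%VS).
have frequent_mem B : B \in frequent_traces -> indic U B \in (p @^-1: S)%VS.
  move=> Bf; rewrite -memv_preim lfunE; apply: memv_span.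
  exact: (image_f (indic_class U)).
have pairS (x y : {x : G | x \in U}) :
    indic U [set val x] + indic U [set val y] \in (p @^-1: S)%VS.
  have /connectP [s] := connH x y.
  (* The edge vectors along a path telescope: inner vertices occur twice and cancel. *)
  elim: s x => [|z s IHs] x /= => [_ -> | /andP [/andP [xz qz] path_s] last_s].
    by rewrite F2_addvv mem0v.
  have xzS : indic U [set val x] + indic U [set val z] \in (p @^-1: S)%VS.
    rewrite -indic_set2 // frequent_mem // inE qz andbT.
    by apply/subsetP => t; rewrite !inE => /orP [] /eqP ->; apply: valP.
  have := memvD xzS (IHs z path_s last_s).
  by rewrite -addrA [X in _ + X]addrA F2_addvv add0r.
have [C [CU oddC' CS]] : exists C : {set G},
    [/\ C \subset U, odd #|C| & indic U C \in (p @^-1: S)%VS].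
  have [oddU | /oddC [C [CU C1 qC]]] := boolP (odd #|U|).
    (* For m odd, U itself serves: its class is zero, so 1_U is in the preimage whether or not U is
       a frequent trace. *)
    exists U; split=> //; rewrite -memv_preim lfunE /=.
    have /eqP -> : vclass <[indic U U]>%VS (indic U U) == vclass _ 0.
      by rewrite vclass_eq subr0 memv_line.
    by rewrite linear0 mem0v.
  by exists C; split=> //; apply: frequent_mem; rewrite inE CU.
have preim_full := indic_full pairS CU oddC' CS.
apply/vspaceP => x; rewrite memvf -(vclass_reprK x).
have := memvf (repr x); rewrite -preim_full -memv_preim.
by rewrite lfunE.
Qed.

(** * Blocks of q vertices with a common trace, and the effect of deleting them *)

Definition trace_block B : {set G} :=
  [set x in take q (enum [set x in A :\: U | trace U x == B])].

Lemma trace_block_mem B x :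
  x \in trace_block B -> (x \in A :\: U) /\ trace U x = B.
Proof.
by rewrite inE => /mem_take; rewrite mem_enum inE => /andP [-> /eqP].
Qed.

Lemma card_trace_block B : (q <= trace_mult A U B)%N -> #|trace_block B| = q.
Proof.
move=> qB; rewrite cardsE; rewrite (card_uniqP _) ?take_uniq ?enum_uniq //.
by rewrite size_takel // -cardE.
Qed.

Lemma trace_block_disjoint B C x :
  x \in trace_block B -> x \in trace_block C -> B = C.
Proof. by move=> /trace_block_mem [_ <-] /trace_block_mem [_ <-]. Qed.

Section Deletion.
Variable I : {set {set G}}.
Hypotheses (qI : {in I, forall B, (q <= trace_mult A U B)%N}) (q_gt0 : (0 < q)%N).

Definition deleted := cover (trace_block @: I).

Lemma trace_block_neq0 B : B \in I -> trace_block B != set0.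
Proof. by move=> BI; rewrite -card_gt0 card_trace_block ?qI. Qed.

(** Any vertex of a block determines its trace, and blocks are nonempty since q > 0. Thus counting
    blocks amounts to counting traces. *)
Lemma trace_block_inj : {in I &, injective trace_block}.
Proof.
move=> B C BI _ eqBC; have /set0Pn [x xB] := trace_block_neq0 BI.
by apply: (trace_block_disjoint xB); rewrite -eqBC.
Qed.

Lemma trivI_trace_block : trivIset (trace_block @: I).
Proof.
apply/trivIsetP => _ _ /imsetP [B _ ->] /imsetP [C _ ->] neqBC.
rewrite -setI_eq0; apply/eqP/setP => x; rewrite in_setI in_set0.
apply/negP => /andP [xB xC].
by rewrite (trace_block_disjoint xB xC) eqxx in neqBC.
Qed.

Lemma deleted_sub : deleted \subset A :\: U.
Proof.
apply/bigcupsP => _ /imsetP [B _ ->]; apply/subsetP => x.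
by case/trace_block_mem.
Qed.

Lemma card_deleted : #|deleted| = (q * #|I|)%N.
Proof.
have /eqP <- := trivI_trace_block; rewrite big_imset /=; last exact: trace_block_inj.
rewrite (eq_bigr (fun=> q)) => [|B BI]; last by rewrite card_trace_block ?qI.
by rewrite sum_nat_const mulnC.
Qed.

Lemma deleted_blocks : trace_block_union q U deleted.
Proof.
exists (trace_block @: I); split=> // [|_ /imsetP [B BI ->]].
  exact: trivI_trace_block.
split; first by rewrite card_trace_block ?qI.
by exists B => x /trace_block_mem [].
Qed.

(** A block of trace B lies inside the neighbourhood of u if u is in B, and misses it otherwise. *)
Lemma deg_deleted (u : G) : u \in U ->
  #|nbhd u :&: deleted| = (q * #|[set B in I | u \in B]|)%N.
Proof.
move=> uU; pose J := [set B in I | u \in B].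
have -> : nbhd u :&: deleted = cover (trace_block @: J).
  apply/setP => x; rewrite inE; apply/andP/bigcupP => [[ux] | ].
    case/bigcupP => _ /imsetP [B BI ->] xB; exists (trace_block B) => //.
    apply: imset_f; rewrite inE BI; have [_ <-] := trace_block_mem xB.
    by rewrite !inE uU andbT adj_sym; rewrite inE in ux.
  case=> _ /imsetP [B + ->] xB; rewrite inE => /andP [BI uB]; split.
    have [_ eqB] := trace_block_mem xB; move: uB; rewrite -eqB !inE adj_sym.
    by case/andP.
  by apply/bigcupP; exists (trace_block B); rewrite ?imset_f.
have trivJ : trivIset (trace_block @: J).
  apply: trivIsetS trivI_trace_block; apply: imsetS.
  by apply/subsetP => B; rewrite inE => /andP [].
have /eqP <- := trivJ; rewrite big_imset /=; last first.
  move=> B C; rewrite !inE => /andP [BI _] /andP [CI _].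
  exact: trace_block_inj.
rewrite (eq_bigr (fun=> q)) => [|B]; first by rewrite sum_nat_const mulnC.
by rewrite inE => /andP [BI _]; rewrite card_trace_block ?qI.
Qed.

Lemma deg_after_deletion (u : G) : u \in U ->
  (deg (A :\: deleted) u + q * #|[set B in I | u \in B]| = deg A u)%N.
Proof.
move=> uU; rewrite -deg_deleted // /deg -(cardsID deleted (nbhd u :&: A)) addnC.
rewrite setIDA; congr (#|pred_of_set _| + _)%N; rewrite -setIA; congr (_ :&: _).
by apply/esym/setIidPr; apply: subset_trans deleted_sub (subsetDl _ _).
Qed.

End Deletion.

(** * Choosing the blocks that balance the degrees on U *)

Lemma exists_balancing_deletion :
  (0 < q)%N -> modular q A -> U \subset A -> (0 < #|U|)%N ->
  <<[seq indic_class U B | B in frequent_traces]>>%VS = fullv ->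
  exists E : {set G}, balancing_deletion q A U E.
Proof.
move=> q0 modA UA U0 spanU.
pose f : F2pow U := [ffun x => (deg A (val x) %/ q)%:R].
have : vclass <[indic U U]>%VS f \in <<map (indic_class U) (enum frequent_traces)>>%VS.
  by rewrite spanU memvf.
case/F2_short_sum => t [sub_t size_t sum_t].
have uniq_t : uniq t := subseq_uniq sub_t (enum_uniq _).
pose I := [set B in t].
have qI : {in I, forall B, (q <= trace_mult A U B)%N}.
  move=> B; rewrite inE => /(mem_subseq sub_t).
  by rewrite mem_enum inE => /andP [].
have cardI : #|I| = size t by rewrite cardsE; apply/card_uniqP.
(* Lifting the equality of classes to vectors costs a multiple of 1_U; its coefficient [c] will be
   the common parity of the quotients by q after deletion. *)
have [c fE] : exists c : 'F_2, f = \sum_(B <- t) indic U B + c *: indic U U.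
  have : f - \sum_(B <- t) indic U B \in <[indic U U]>%VS.
    by rewrite -vclass_eq sum_t linear_sum.
  by case/vlineP => c eqc; exists c; rewrite -eqc addrC subrK.
have parity u : u \in U ->
    ((deg A u %/ q)%:R = (#|[set B in I | u \in B]|)%:R + c :> 'F_2).
  move=> uU; have /ffunP /(_ (Sub u uU)) := fE.
  rewrite !ffunE sum_ffunE /= uU /GRing.scale /= mulr1 => ->; congr (_ + _).
  rewrite -sum1_card natr_sum.
  rewrite [RHS](eq_bigl (fun B => (B \in t) && (u \in B))); last first.
    by move=> B; rewrite !inE.
  rewrite big_mkcondr /= -big_uniq //=; apply: eq_bigr => B _.
  by rewrite ffunE /=; case: (u \in B).
exists (deleted I); split.
- exact: deleted_sub.
- by rewrite card_deleted // leq_mul2l cardI -dim_trace_quotient // size_t orbT.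
- exact: deleted_blocks.
move=> u v uU vU.
(* Deletion lowers the quotient by q and keeps the remainder. The inequality ensures that the
   subtraction in nat is not truncated. *)
have degW w : w \in U -> deg (A :\: deleted I) w =
    (((deg A w %/ q - #|[set B in I | w \in B]|) * q) + deg A w %% q)%N /\
    (#|[set B in I | w \in B]| <= deg A w %/ q)%N.
  move=> wU; have := deg_after_deletion qI q0 wU.
  set k := #|_|; set d := deg _ _ => <-.
  rewrite [(q * k)%N]mulnC [(d + _)%N]addnC divnMDl // modnMDl.
  by rewrite addKn -divn_eq leq_addr.
have [-> leu] := degW u uU; have [-> lev] := degW v vU.
rewrite -(modA u v) ?(subsetP UA) //.
set a := (_ - _)%N; set b := (_ - _)%N.
(* The remainders modulo q agree by [modA], so modulo 2q only the parities of the quotients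
   matter. *)
suff odd_ab : odd a = odd b.
  apply/eqP; rewrite eqn_modDr.
  rewrite -(odd_double_half a) -(odd_double_half b) odd_ab !mulnDl eqn_modDl.
  by rewrite -!muln2 -!mulnA !modnMl.
have eqF2 (x y : nat) : (x%:R == y%:R :> 'F_2) = (odd x == odd y).
  rewrite -val_eqE /= !val_Fp_nat // !modn2.
  by case: (odd x); case: (odd y).
have natF2 w : w \in U -> (#|[set B in I | w \in B]| <= deg A w %/ q)%N ->
    (deg A w %/ q - #|[set B in I | w \in B]|)%:R = c :> 'F_2.
  by move=> wU lew; rewrite natrB // parity // addrC addKr.
by apply/eqP; rewrite -eqF2 /a /b !natF2.
Qed.

End Balancing.

Close Scope ring_scope.

(** * Assembly of the three conclusions *)

Theorem mainTheorem7 (G : sgraph) (q m : nat) (A U : {set G}) :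
  (exists k : nat, q = 2 ^ k) ->
  modular q A ->
  U \subset A ->
  #|U| = m ->
  2 <= m ->
  connected (H2 q A U) ->
  (~~ odd m ->
     exists C : {set G}, [/\ C \subset U, odd #|C| & q <= trace_mult A U C]) ->
  [/\ <<[seq indic_class U B
          | B in [pred B : {set G} | (B \subset U) && (q <= trace_mult A U B)%N]]>>%VS
        = fullv,
      exists E : {set G}, balancing_deletion q A U E &
      forall E : {set G}, balancing_deletion q A U E ->
        let W := A :\: E in
        (forall x u : G, x \in W :\: U -> u \in U ->
           deg W x = deg W u %[mod 2 * q]) ->
        modular (2 * q) W].
Proof.
move=> [k qk] modA UA cardU m2 connH oddC.
have q0 : 0 < q by rewrite qk expn_gt0.
have U0 : 0 < #|U| by rewrite cardU ltnW.
rewrite -cardU in oddC; have spanU := frequent_traces_span U0 connH oddC.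
split=> //; first exact: exists_balancing_deletion.
move=> E [_ _ _ congU] W congW.
(* A fixed vertex of U serves as reference: every degree in [W] is compared with that of [u]. *)
have [u uU] := card_gt0P U0.
have degWu x : x \in W -> deg W x = deg W u %[mod 2 * q].
  move=> xW; have [xU | xU] := boolP (x \in U); first exact: congU.
  by apply: congW; rewrite // inE xU.
by move=> x y xW yW; rewrite !degWu.
Qed.
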